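(* Let $a \ge 2$ be even and $A = \{0,1,\dots,a-1\}$. Let $M = a^3/4$. For $i \in \{1,\dots,M\}$ define letters $x_i, y_i, z_i \in A$ as follows: (1) $\langle x_i\rangle$ is the sequence consisting of $a^2/2$ letters $0,1,0,1,\dots,0,1$, followed by $a^2/2$ letters $2,3,2,3,\dots,2,3$, and so on, ending with $a^2/2$ letters $a-2,a-1,\dots,a-2,a-1$; explicitly $x_i = 2\lfloor (i-1)/(a^2/2)\rfloor + ((i-1) \bmod 2)$. (2) $\langle y_i\rangle$ is the sequence of $a^2/2$ letters consisting of $a$ letters $0,1,\dots,0,1$, then $a$ letters $2,3,\dots,2,3$, and so on up to $a$ letters $a-2,a-1,\dots,a-2,a-1$, repeated $a/2$ times; explicitly $y_i = 2\lfloor ((i-1) \bmod (a^2/2))/a\rfloor + ((i-1)\bmod 2)$. (3) $\langle z_i\rangle$ is the sequence $1,0,3,2,5,4,\dots,a-1,a-2$ of length $a$ repeated $a^2/4$ times; explicitly, with $r = (i-1) \bmod a$, $z_i = r+1$ if $r$ is even and $z_i = r-1$ if $r$ is odd. Let $w_i$ be the three-letter word $x_iy_iz_i$, and let $$u = w_1\,\diamond\, w_2\,\diamond\,\cdots\,\diamond\, w_M\,\diamond\, w_1.$$ Then $u$ is a universal partial word for $A^4$.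
   Context: A partial word over $A$ is a finite sequence of characters from $A \cup \{\diamond\}$, where $\diamond \notin A$ is a wild-card symbol; a word over $A$ contains no $\diamond$. $A^n$ denotes the set of words of length $n$ over $A$. For $x = x_1\cdots x_n \in A^n$ and a partial word $w = w_1\cdots w_N$, the position $i$ ($0 \le i \le N-n$) covers $x$ if $x_j = w_{i+j}$ for every $1\le j\le n$ with $w_{i+j}\in A$. A universal partial word for $A^n$ is a partial word $w$ such that every word in $A^n$ is covered by exactly one position of $w$. *)

(* Defs.v *)
From mathcomp Require Import all_boot.
From mathcomp Require Import zify.

Set Implicit Arguments.
Unset Strict Implicit.
Unset Printing Implicit Defensive.

(* A partial word over A; [None] is the wild-card symbol. *)
Definition pword (A : Type) := seq (option A).

(* Positions are numbered from 0, so the letters read at position i are those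
   of index i, ..., i + n - 1 of w.  The bound i + n <= size w (rather than
   i <= size w - n, which is truncated) also excludes every position when w is
   shorter than n, and keeps the default value of [nth] out of play. *)
Definition covers (A : Type) (n : nat) (w : pword A) (x : n.-tuple A)
    (i : nat) : Prop :=
  i + n <= size w /\
  forall (j : 'I_n) (c : A), nth None w (i + j) = Some c -> tnth x j = c.

Definition universal_pword (A : Type) (n : nat) (w : pword A) : Prop :=
  forall x : n.-tuple A, exists! i : nat, covers w x i.

Definition M (a : nat) : nat := a ^ 3 %/ 4.

(* The values of x_i, y_i, z_i as natural numbers, for 1 <= i <= M a. *)
Definition x_val (a i : nat) : nat :=
  2 * ((i - 1) %/ (a ^ 2 %/ 2)) + (i - 1) %% 2.

Definition y_val (a i : nat) : nat :=
  2 * (((i - 1) %% (a ^ 2 %/ 2)) %/ a) + (i - 1) %% 2.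

Definition z_val (a i : nat) : nat :=
  let r := (i - 1) %% a in if odd r then r - 1 else r + 1.

Section Letters.

Variable a : nat.
Hypothesis a_ge2 : 2 <= a.
Hypothesis a_even : ~~ odd a.

Lemma M_gt0 : 0 < M a.
Proof.
rewrite /M divn_gt0 //.
by apply: (@leq_trans (2 ^ 3)) => //; rewrite leq_exp2r.
Qed.

Let half_sq : exists b, [/\ 0 < b, a = 2 * b, a ^ 2 %/ 2 = 2 * b * b
                          & M a = 2 * b * b * b].
Proof.
exists a./2; have ea : a = 2 * a./2 by lia.
split; [lia | exact: ea | |].
- by rewrite {1}ea (_ : _ ^ 2 = 2 * a./2 * a./2 * 2) ?mulnK //; nia.
- by rewrite /M {1}ea (_ : _ ^ 3 = 2 * a./2 * a./2 * a./2 * 4) ?mulnK // !expnS expn0; nia.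
Qed.

Lemma x_val_lt (i : 'I_(M a)) : x_val a i.+1 < a.
Proof.
have [b [b0 ea eh eM]] := half_sq.
rewrite /x_val eh subn1 /=.
have hi : i %/ (2 * b * b) < b.
  by rewrite ltn_divLR ?muln_gt0 ?b0 //; move: (ltn_ord i); rewrite {2}eM; lia.
by lia.
Qed.

Lemma y_val_lt (i : 'I_(M a)) : y_val a i.+1 < a.
Proof.
have [b [b0 ea eh eM]] := half_sq.
rewrite /y_val eh subn1 /=.
have hm : i %% (2 * b * b) < 2 * b * b by rewrite ltn_mod !muln_gt0 b0.
have hi : (i %% (2 * b * b)) %/ a < b.
  by rewrite ltn_divLR; [apply: leq_trans hm _; nia | lia].
by lia.
Qed.

Lemma z_val_lt (i : 'I_(M a)) : z_val a i.+1 < a.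
Proof.
rewrite /z_val subn1 /=.
have : i %% a < a by rewrite ltn_mod; lia.
by case: ifP => h; lia.
Qed.

(* An index i : 'I_(M a) stands for the index i + 1 of {1, ..., M}. *)
Definition x_letter (i : 'I_(M a)) : 'I_a := Ordinal (x_val_lt i).
Definition y_letter (i : 'I_(M a)) : 'I_a := Ordinal (y_val_lt i).
Definition z_letter (i : 'I_(M a)) : 'I_a := Ordinal (z_val_lt i).

Definition w_word (i : 'I_(M a)) : pword 'I_a :=
  [:: Some (x_letter i); Some (y_letter i); Some (z_letter i)].

Definition u_word : pword 'I_a :=
  flatten [seq rcons (w_word i) None | i <- enum 'I_(M a)]
    ++ w_word (Ordinal M_gt0).

End Letters.

(* Main.v *)
Require Import Defs.
From mathcomp Require Import all_boot.
From mathcomp Require Import zify.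

(* Write a = 2b.  An index k < M = 2b^3 has a mixed-radix expansion
   k = X (2 b^2) + Y (2b) + r with X, Y < b and r < 2b; if e is the parity of
   k, then x, y, z have parities e, e, 1 - e, the letter z encodes r, and x, y
   encode X, Y.  A window of u at offset s in block k reads three letters, taken
   from block k and its cyclic successor k'.  The parities of a word determine s.
   The letters z, y, x then give, in this order, k mod 2b, k mod 2b^2 and k; as
   2b | 2b^2 | M, these congruences carry over from k to k', so it is
   harmless that the z (and y) letters are read in block k and the others in
   block k'. *)

Set Implicit Arguments.
Unset Strict Implicit.
Unset Printing Implicit Defensive.

(** The involution swapping 2n and 2n + 1. The letter z is [flip] of the residue of the index mod
    [a]. *)
Definition flip (r : nat) : nat := if odd r then r - 1 else r + 1.

Lemma flipK : involutive flip.
Proof. by move=> r; rewrite /flip; case: (boolP (odd r)) => h; case: ifP => h'; lia. Qed.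

Lemma odd_flip r : odd (flip r) = ~~ odd r.
Proof. by rewrite /flip; case: ifP => h; lia. Qed.

Lemma flip_lt b r : r < 2 * b -> flip r < 2 * b.
Proof. by rewrite /flip; case: ifP => h; lia. Qed.

Lemma odd_mod_double b k : odd (k %% (2 * b)) = odd k.
Proof. by rewrite {2}(divn_eq k (2 * b)) oddD !oddM /= andbF. Qed.

Lemma double_odd_inj m n (e f : bool) :
  2 * m + e = 2 * n + f <-> m = n /\ e = f.
Proof. by case: e; case: f; split=> [|[]]; lia. Qed.

Lemma half_odd v : v = 2 * v./2 + odd v.
Proof. lia. Qed.

Lemma digit_lt b d x y : x < b -> y < d -> x * d + y < b * d.
Proof.
move=> xb yd; apply: (@leq_trans (x.+1 * d)); last by rewrite leq_mul2r xb orbT.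
by rewrite mulSnr ltn_add2l.
Qed.

Lemma eq_from_divn_modn d m n : m %/ d = n %/ d -> m = n %[mod d] -> m = n.
Proof. by move=> hd hm; rewrite (divn_eq m d) (divn_eq n d) hd hm. Qed.

Lemma modn_dvdm_eq d e m n : d %| e -> m = n %[mod e] -> m = n %[mod d].
Proof. by move=> de h; rewrite -(modn_dvdm m de) h modn_dvdm. Qed.

Lemma succ_mod_inj n k l :
  k < n -> l < n -> k.+1 %% n = l.+1 %% n -> k = l.
Proof.
move=> kn ln /eqP; rewrite -(addn1 k) -(addn1 l) eqn_modDr => /eqP.
by rewrite !modn_small.
Qed.

Lemma succ_mod_surj n k : k < n -> exists2 l, l < n & l.+1 %% n = k.
Proof.
case: k => [|k] kn; last by exists k; [lia | rewrite modn_small].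
by exists n.-1; [lia | rewrite prednK // modnn].
Qed.

(** * Letters as mixed-radix digits of the block index *)

Section Digits.

Variable b : nat.
Local Notation a := (2 * b).
Local Notation N := (b * a).
Local Notation m := (b * N).

Lemma M_double : M a = m.
Proof. by rewrite /M (_ : _ ^ 3 = m * 4) ?mulnK //; nia. Qed.

Lemma half_sq_double : a ^ 2 %/ 2 = N.
Proof. by rewrite (_ : _ ^ 2 = N * 2) ?mulnK //; nia. Qed.

Lemma x_valP k v : v = x_val a k.+1 <-> k %/ N = v./2 /\ odd k = odd v.
Proof.
rewrite /x_val half_sq_double subn1 /= modn2 {1}(half_odd v).
by rewrite double_odd_inj; split=> [] [-> ->].
Qed.

Lemma y_valP k v : v = y_val a k.+1 <-> (k %% N) %/ a = v./2 /\ odd k = odd v.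
Proof.
rewrite /y_val half_sq_double subn1 /= modn2 {1}(half_odd v).
by rewrite double_odd_inj; split=> [] [-> ->].
Qed.

Lemma z_valP k v : v = z_val a k.+1 <-> k %% a = flip v.
Proof.
rewrite /z_val subn1 /= -/(flip _).
by split=> [->|->]; rewrite flipK.
Qed.

Lemma z_val_odd k v : v = z_val a k.+1 -> odd v = ~~ odd k.
Proof. by move/z_valP=> h; rewrite -(odd_mod_double b k) h odd_flip negbK. Qed.

Lemma y_val_odd k v : v = y_val a k.+1 -> odd v = odd k.
Proof. by case/y_valP. Qed.

Lemma x_val_odd k v : v = x_val a k.+1 -> odd v = odd k.
Proof. by case/x_valP. Qed.

Lemma a_dvd_N : a %| N. Proof. exact: dvdn_mull. Qed.
Lemma N_dvd_m : N %| m. Proof. exact: dvdn_mull. Qed.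

Lemma odd_succ_mod k : odd (k.+1 %% m) = ~~ odd k.
Proof.
have -> : m = 2 * (b * b * b) by nia.
by rewrite odd_mod_double.
Qed.

Lemma eq_mod_a k l v : v = z_val a k.+1 -> v = z_val a l.+1 -> k = l %[mod a].
Proof. by move=> /z_valP -> /z_valP ->. Qed.

Lemma eq_mod_N k l v : k = l %[mod a] ->
  v = y_val a k.+1 -> v = y_val a l.+1 -> k = l %[mod N].
Proof.
move=> kl /y_valP[hk _] /y_valP[hl _].
apply: (@eq_from_divn_modn a); first by rewrite hk hl.
by rewrite !(modn_dvdm _ a_dvd_N).
Qed.

Lemma eq_x_val k l v : k = l %[mod N] ->
  v = x_val a k.+1 -> v = x_val a l.+1 -> k = l.
Proof.
by move=> kl /x_valP[hk _] /x_valP[hl _]; apply: (eq_from_divn_modn _ kl); rewrite hk hl.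
Qed.

Lemma succ_mod_eq d k l : d %| m -> k = l %[mod d] ->
  k.+1 %% m = l.+1 %% m %[mod d].
Proof.
by move=> dm kl; rewrite !modn_dvdm // -(addn1 k) -(addn1 l) -modnDml kl modnDml.
Qed.

(** Only one successor is reduced mod [m]: [k] will be an index obtained from its cyclic successor,
    [l] a plain representative built from digits. *)
Lemma succ_mod_cancel d k l : d %| m -> k.+1 %% m = l.+1 %[mod d] ->
  k = l %[mod d].
Proof.
move=> dm; rewrite modn_dvdm // => /eqP.
by rewrite -(addn1 k) -(addn1 l) eqn_modDr => /eqP.
Qed.

Hypothesis b_gt0 : 0 < b.

Lemma a_gt0 : 0 < a. Proof. lia. Qed.
Lemma N_gt0 : 0 < N. Proof. by rewrite !muln_gt0 b_gt0. Qed.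

Lemma xyz_surj p q r : p < a -> q < a -> r < a ->
  odd p = odd q -> odd r = ~~ odd p ->
  exists2 k, k < m & [/\ p = x_val a k.+1, q = y_val a k.+1 & r = z_val a k.+1].
Proof.
move=> pa qa ra pq rp; have fr := flip_lt ra.
have j_lt : q./2 * a + flip r < N by apply: digit_lt => //; lia.
(* The halves of [p] and [q] are the two upper digits. Since [N] and [a] are even, the parity is
   that of [flip r]. *)
exists (p./2 * N + (q./2 * a + flip r)); first by apply: digit_lt => //; lia.
have ek : odd (p./2 * N + (q./2 * a + flip r)) = odd p.
  by rewrite !oddD !oddM odd_flip rp /= !andbF negbK.
split.
- by apply/x_valP; rewrite divnMDl ?N_gt0 // (divn_small j_lt) addn0.
- by apply/y_valP; rewrite modnMDl (modn_small j_lt) divnMDl ?a_gt0 //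
    (divn_small fr) addn0 ek.
- by apply/z_valP; rewrite mulnA addnA -mulnDl modnMDl modn_small.
Qed.

Lemma yz_x_surj q r p : q < a -> r < a -> p < a ->
  odd r = ~~ odd q -> odd p = odd r ->
  exists2 k, k < m &
    [/\ q = y_val a k.+1, r = z_val a k.+1 & p = x_val a (k.+1 %% m).+1].
Proof.
move=> qa ra pa rq pr; have fr := flip_lt ra.
set j := q./2 * a + flip r.
have j_lt : j < N by apply: digit_lt => //; lia.
have j'_lt : j.+1 %% N < N by rewrite ltn_mod N_gt0.
(* The letters y and z force [k] to be [j] mod [N], and x fixes the top digit of the successor. So
   the successor is built first, and [k] is its cyclic predecessor. *)
have [|k km ek] := @succ_mod_surj m (p./2 * N + j.+1 %% N); first by apply: digit_lt => //; lia.
have kj : k = j %[mod N].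
  by apply: succ_mod_cancel N_dvd_m _; rewrite ek modnMDl modn_mod.
have kja : k %% a = flip r.
  by rewrite (modn_dvdm_eq a_dvd_N kj) modnMDl modn_small.
have ok : odd k = odd q by rewrite -(odd_mod_double b) kja odd_flip rq negbK.
exists k => //; split.
- apply/y_valP; rewrite kj (modn_small j_lt) divnMDl ?a_gt0 //.
  by rewrite (divn_small fr) addn0.
- exact/z_valP.
- apply/x_valP; rewrite odd_succ_mod ok pr rq; split=> //.
  by rewrite ek divnMDl ?N_gt0 // (divn_small j'_lt) addn0.
Qed.

Lemma z_xy_surj r p q : r < a -> p < a -> q < a ->
  odd p = odd r -> odd q = odd r ->
  exists2 k, k < m &
    [/\ r = z_val a k.+1, p = x_val a (k.+1 %% m).+1
      & q = y_val a (k.+1 %% m).+1].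
Proof.
move=> ra pa qa pr qr; have fr := flip_lt ra.
(* The lowest digit of the successor, forced by z; its two upper digits are free and come from [p]
   and [q]. *)
set j := (flip r).+1 %% a.
have ja : j < a by rewrite ltn_mod a_gt0.
have j_lt : q./2 * a + j < N by apply: digit_lt => //; lia.
have [|k km ek] := @succ_mod_surj m (p./2 * N + (q./2 * a + j)); first by apply: digit_lt => //; lia.
have kja : k %% a = flip r.
  rewrite -[RHS](modn_small fr).
  apply: succ_mod_cancel (dvdn_trans a_dvd_N N_dvd_m) _.
  by rewrite ek mulnA addnA -mulnDl modnMDl modn_mod.
have ok : odd (k.+1 %% m) = odd r.
  by rewrite odd_succ_mod -(odd_mod_double b) kja odd_flip negbK.
exists k => //; split.
- exact/z_valP.
- apply/x_valP; rewrite ok pr; split=> //.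
  by rewrite ek divnMDl ?N_gt0 // (divn_small j_lt) addn0.
- apply/y_valP; rewrite ok qr; split=> //.
  by rewrite ek modnMDl (modn_small j_lt) divnMDl ?a_gt0 // (divn_small ja) addn0.
Qed.

(** * Windows as arithmetic conditions on four letters *)

(** At offset [s] the wild card falls on the letter of index 3 - s, counted from 0, so that letter
    is unconstrained. *)
Definition covers_at (p q r t k s : nat) : Prop :=
  let k' := k.+1 %% m in
  match s with
  | 0 => [/\ p = x_val a k.+1, q = y_val a k.+1 & r = z_val a k.+1]
  | 1 => [/\ p = y_val a k.+1, q = z_val a k.+1 & t = x_val a k'.+1]
  | 2 => [/\ p = z_val a k.+1, r = x_val a k'.+1 & t = y_val a k'.+1]
  | _ => [/\ q = x_val a k'.+1, r = y_val a k'.+1 & t = z_val a k'.+1]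
  end.

(* The offset depends only on the parities of the four letters: each of the 16
   parity patterns satisfies exactly one of the four conditions. *)
Definition offset (p q r t : nat) : nat :=
  if (odd p == odd q) && (odd q != odd r) then 0
  else if (odd p != odd q) && (odd q == odd t) then 1
  else if (odd p == odd r) && (odd r == odd t) then 2 else 3.

(** If e is the parity of [k], the three letters read have parities e, e, 1 - e at offset 0; e, 1 -
    e, 1 - e at offset 1; 1 - e throughout at offset 2; and 1 - e, 1 - e, e at offset 3, as the
    successor has the opposite parity. *)
Lemma covers_at_offset p q r t k s :
  s < 4 -> covers_at p q r t k s -> s = offset p q r t.
Proof.
rewrite /offset; case: s => [|[|[|[|s]]]] // _ [].
- by move=> /x_val_odd -> /y_val_odd -> /z_val_odd ->; case: odd.
- move=> /y_val_odd -> /z_val_odd -> /x_val_odd ->.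
  by rewrite odd_succ_mod; case: odd.
- move=> /z_val_odd -> /x_val_odd -> /y_val_odd ->.
  by rewrite odd_succ_mod; case: odd => //; case: odd.
- move=> /x_val_odd -> /y_val_odd -> /z_val_odd ->.
  by rewrite odd_succ_mod; case: odd => //; case: odd.
Qed.

Lemma covers_at_inj p q r t k l s : k < m -> l < m ->
  covers_at p q r t k s -> covers_at p q r t l s -> k = l.
Proof.
have am := dvdn_trans a_dvd_N N_dvd_m.
move=> km lm; case: s => [|[|[|s]]] [h1 h2 h3] [g1 g2 g3].
- exact: eq_x_val (eq_mod_N (eq_mod_a h3 g3) h2 g2) h1 g1.
(* From offset 1 on, x belongs to the successor block, so the successors are identified first. *)
- apply: (succ_mod_inj km lm); apply: eq_x_val h3 g3.
  exact: succ_mod_eq N_dvd_m (eq_mod_N (eq_mod_a h2 g2) h1 g1).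
- apply: (succ_mod_inj km lm); apply: eq_x_val h2 g2.
  exact: eq_mod_N (succ_mod_eq am (eq_mod_a h1 g1)) h3 g3.
- apply: (succ_mod_inj km lm).
  exact: eq_x_val (eq_mod_N (eq_mod_a h3 g3) h2 g2) h1 g1.
Qed.

Lemma covers_at_exists p q r t : p < a -> q < a -> r < a -> t < a ->
  exists2 k, k < m & covers_at p q r t k (offset p q r t).
Proof.
move=> pa qa ra ta; rewrite /offset.
case: ifP => [/andP[/eqP h1 h2]|n0]; first by apply: xyz_surj => //; lia.
case: ifP => [/andP[h1 /eqP h2]|n1]; first by apply: yz_x_surj => //; lia.
case: ifP => [/andP[/eqP h1 /eqP h2]|n2]; first by apply: z_xy_surj => //; lia.
(* Once the other three patterns fail, [q] and [r] share a parity that [t] does not: a full block,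
   whose predecessor is the required index. *)
have [||l lm hl] := xyz_surj qa ra ta; try lia.
by have [k km ek] := succ_mod_surj lm; exists k => //=; rewrite ek.
Qed.

End Digits.

(** * From the partial word to the arithmetic conditions *)

Definition letter_val (a t k : nat) : nat :=
  match t with 0 => x_val a k.+1 | 1 => y_val a k.+1 | _ => z_val a k.+1 end.

Lemma size_flatten_const (T U : Type) (c : nat) (f : T -> seq U) s :
  (forall y, size (f y) = c) -> size (flatten [seq f y | y <- s]) = c * size s.
Proof.
by move=> fc; elim: s => [|y s IH] /=; rewrite ?muln0 // size_cat fc IH mulnS.
Qed.

Lemma nth_flatten_const (T U : Type) (c : nat) (f : T -> seq U) x0 y0 s k t :
  (forall y, size (f y) = c) -> k < size s -> t < c ->
  nth x0 (flatten [seq f y | y <- s]) (c * k + t) = nth x0 (f (nth y0 s k)) t.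
Proof.
move=> fc; elim: s k => [|y s IH] [|k] //= ks tc.
  by rewrite muln0 nth_cat fc tc.
rewrite nth_cat fc (_ : (_ < c) = false); last by rewrite mulnS; lia.
by rewrite -IH // mulnS -addnA addKn.
Qed.

Section Word.

Variables (a : nat) (a_ge2 : 2 <= a) (a_even : ~~ odd a).

Local Notation u := (u_word a_ge2 a_even).
Local Notation block i := (rcons (w_word a_ge2 a_even i) None).

Lemma size_u_prefix :
  size (flatten [seq block i | i <- enum 'I_(M a)]) = 4 * M a.
Proof.
by rewrite (@size_flatten_const _ _ 4) // size_enum_ord.
Qed.

Lemma size_u : size u = 4 * M a + 3.
Proof. by rewrite size_cat size_u_prefix. Qed.

Lemma nth_block i t : t < 4 ->
  omap val (nth None (block i) t) =
    if t == 3 then None else Some (letter_val a t i).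
Proof. by case: t => [|[|[|[|t]]]]. Qed.

(** The closing copy of the first block counts as block [M a], which reduction mod [M a] sends to
    block 0; thus the word is read cyclically. *)
Lemma nth_u k t : t < 4 -> 4 * k + t < 4 * M a + 3 ->
  omap val (nth None u (4 * k + t)) =
    if t == 3 then None else Some (letter_val a t (k %% M a)).
Proof.
move=> t4 kt; have M0 := M_gt0 a_ge2.
rewrite nth_cat size_u_prefix; case: ltnP => hk.
  have kM : k < M a by lia.
  rewrite (nth_flatten_const _ (Ordinal M0)) ?size_enum_ord //.
  by rewrite nth_block // nth_enum_ord // modn_small.
have -> : k = M a by lia.
rewrite addKn modnn; have t3 : t < 3 by lia.
by case: t t3 {t4 kt hk} => [|[|[|t]]].
Qed.

Lemma covers_uP (c : 4.-tuple 'I_a) (k s : nat) : s < 4 -> k < M a ->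
  covers u c (4 * k + s) <->
  forall j, j < 4 -> (s + j) %% 4 != 3 ->
    val (tnth c (inord j)) = letter_val a ((s + j) %% 4) (if s + j < 4 then k else k.+1 %% M a).
Proof.
move=> s4 kM.
have nthE (j : 'I_4) : omap val (nth None u (4 * k + s + j)) =
    if (s + j) %% 4 == 3 then None
    else Some (letter_val a ((s + j) %% 4) (if s + j < 4 then k else k.+1 %% M a)).
  have j4 := ltn_ord j.
  have -> : (if s + j < 4 then k else k.+1 %% M a) = (k + (s + j) %/ 4) %% M a.
    case: ltnP => hsj; first by rewrite divn_small // addn0 modn_small.
    by rewrite (_ : (s + j) %/ 4 = 1) ?addn1 //; lia.
  rewrite -nth_u ?ltn_mod //; last by lia.
  by congr (omap _ (nth _ _ _)); lia.
split=> [[_ h] j j4 sj|h].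
  move: (nthE (inord j)) (h (inord j)); rewrite inordK // (negPf sj).
  by case: nth => [d|//] /= [<-] /(_ d erefl) ->.
(* Every such window fits: its end is at most 4 (M - 1) + 3 + 4 = 4 M + 3. *)
split=> [|j d hd]; first by rewrite size_u; lia.
move: (nthE j) (h j (ltn_ord j)); rewrite hd /= inord_val.
by case: ifP => // _ [<-] /(_ isT) /val_inj.
Qed.

End Word.

Theorem theorem5p2 (a : nat) (a_ge2 : 2 <= a) (a_even : ~~ odd a) :
  universal_pword 4 (u_word a_ge2 a_even).
Proof.
have [b ea] : exists b, a = 2 * b by exists a./2; lia.
subst a; have b0 : 0 < b by lia.
move=> c.
set p := val (tnth c (inord 0)); set q := val (tnth c (inord 1)).
set r := val (tnth c (inord 2)); set t := val (tnth c (inord 3)).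
have coversP k s : s < 4 -> k < M (2 * b) ->
    covers (u_word a_ge2 a_even) c (4 * k + s) <-> covers_at b p q r t k s.
  move=> s4 kM; rewrite covers_uP // M_double.
  case: s s4 => [|[|[|[|s]]]] // _; split=> [h|[h1 h2 h3] [|[|[|[|j]]]] //];
    split; by [apply: (h 0) | apply: (h 1) | apply: (h 2) | apply: (h 3)].
have [k km hk] := covers_at_exists b0 (ltn_ord _ : p < _) (ltn_ord _ : q < _)
  (ltn_ord _ : r < _) (ltn_ord _ : t < _).
have o4 : offset p q r t < 4 by rewrite /offset; do 3!case: ifP => // _.
exists (4 * k + offset p q r t); split; first by apply/coversP; rewrite ?M_double.
move=> i hi.
have [e i4] : i = 4 * (i %/ 4) + i %% 4 /\ i %% 4 < 4 by lia.
(* The window fits in length 4 M + 3, so [i] is at most 4 M - 1. *)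
have iM : i %/ 4 < M (2 * b) by case: hi; rewrite size_u; lia.
move: hi; rewrite {1}e => /(coversP _ _ i4 iM) hi.
have es := covers_at_offset i4 hi; rewrite es in hi.
rewrite e es; congr (4 * _ + _).
by apply: (covers_at_inj km _ hk hi); rewrite -M_double.
Qed.
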